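(* Let $Y$ be a set and let $\alpha: Y \to Y$ be a function without a fixed point (i.e., $\alpha(y) \neq y$ for all $y \in Y$). Let $T$ and $S$ be sets and let $\beta: T \to S$ be a function that is onto, i.e., has a right inverse $\bar{\beta}: S \to T$ (so $\beta(\bar{\beta}(s)) = s$ for all $s \in S$). Then for every function $f: T \times S \to Y$, the function $g_\beta: T \to Y$ defined by $$g_\beta(t) = \alpha\bigl(f(t, \beta(t))\bigr) \quad \text{for all } t \in T$$ is not representable by $f$; that is, for all $s \in S$, $g_\beta(-) \neq f(-, s)$ as functions $T \to Y$.
   Context: For a function $f: T \times S \to Y$ and an element $s \in S$, $f(-,s): T \to Y$ denotes the function $t \mapsto f(t,s)$. A function $g: T \to Y$ is called representable by $f$ if there exists $s_0 \in S$ such that $g(-) = f(-, s_0)$, i.e., $g(t) = f(t, s_0)$ for all $t \in T$. The function $g_\beta$ is the composite of $\langle \mathrm{Id}, \beta \rangle : T \to T \times S$, $t \mapsto (t, \beta(t))$, followed by $f: T \times S \to Y$, followed by $\alpha: Y \to Y$. *)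

(* Defs.v *)
From mathcomp Require Import all_boot.

Set Implicit Arguments.
Unset Strict Implicit.
Unset Printing Implicit Defensive.

Definition fixpoint_free (Y : Type) (alpha : Y -> Y) : Prop :=
  forall y : Y, alpha y <> y.

Definition onto (T S : Type) (beta : T -> S) : Prop :=
  exists betabar : S -> T, cancel betabar beta.

Definition slice (T S Y : Type) (f : T * S -> Y) (s : S) : T -> Y :=
  fun t => f (t, s).

(* Equality of functions is pointwise ([=1]), so that non-representability
   does not depend on functional extensionality. *)
Definition representable (T S Y : Type) (f : T * S -> Y) (g : T -> Y) : Prop :=
  exists s0 : S, g =1 slice f s0.

Definition graph_map (T S : Type) (beta : T -> S) : T -> T * S :=
  fun t => (t, beta t).

Definition g_ (T S Y : Type) (alpha : Y -> Y) (f : T * S -> Y) (beta : T -> S) :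
    T -> Y :=
  alpha \o f \o graph_map beta.

(* Main.v *)
Require Import Defs.
From mathcomp Require Import all_boot.

(** Cantor's diagonal argument along the graph of [beta] instead of the usual diagonal. Since [beta]
    is onto, this graph meets every slice [f (-, s)], and at a meeting point [g_] is [alpha] of the
    slice's value, hence different from it. *)

Theorem theorem2 (Y : Type) (alpha : Y -> Y) (alpha_free : fixpoint_free alpha)
    (T S : Type) (beta : T -> S) (beta_onto : onto beta) (f : T * S -> Y) :
  ~ representable f (g_ alpha f beta).
Proof.
case: beta_onto => betabar betabarK [s0 g_repr].
(* At [betabar s0] the diagonal [g_] takes the value [alpha (f (betabar s0, s0))],
   so [f (betabar s0, s0)] would be a fixed point of [alpha]. *)
have := g_repr (betabar s0).
(* Surjectivity enters through [betabarK], which turns [beta (betabar s0)] into [s0], so both sides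
   involve the same value of [f]. *)
by rewrite /g_ /slice /graph_map /= betabarK; apply: alpha_free.
Qed.
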